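(* Let $(\bar\lambda,\bar b,\bar A)\in\mathbb{R}_+\times\mathbb{R}^m\times\mathbb{R}^{m\times n}$ with $\bar\lambda>0$. The following are equivalent: (i) (Condition 1.3 at $(\bar\lambda,\bar b,\bar A)$) there is some $x\in S(\bar\lambda,\bar b,\bar A)$ such that the columns $\bar A_i$ of $\bar A$ with $x_i\neq0$ are linearly independent and $|\bar A_i^\top(\bar b-\bar Ax)|<\bar\lambda$ for all $i\in I$ with $x_i=0$; (ii) $S$ is $\mathcal{C}^\infty$ around $(\bar\lambda,\bar b,\bar A)$ (that is, on some neighborhood of $(\bar\lambda,\bar b,\bar A)$, $S$ is single-valued and, as a function, $\mathcal{C}^\infty$); (iii) there is a unique $(I^+,I^0,I^-)\in\mathcal{J}(\bar A)$ such that the polyhedral cone $P_{1,2}(\mathbb{G}(\bar A,(I^+,I^0,I^-)))$ has $(\bar\lambda,\bar b)$ in its interior, and $S(\cdot,\cdot,\bar A)$ is single-valued and linear on this cone.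
   Context: Notation: $\mathbb{R}_+=[0,\infty)$; $\|\cdot\|$ is the Euclidean norm, $\|\cdot\|_1$ the $\ell_1$-norm; $A_i$ is the $i$th column of $A$; $\operatorname{rge}A$ is the range of $A$ and $\operatorname{proj}_{\operatorname{rge}A}b$ the Euclidean projection of $b$ onto it. Solution multifunction $S:\mathbb{R}\times\mathbb{R}^m\times\mathbb{R}^{m\times n}\rightrightarrows\mathbb{R}^n$: if $\lambda>0$, $S(\lambda,b,A)$ is the set of minimizers over $x\in\mathbb{R}^n$ of $\frac{1}{2\lambda}\|Ax-\operatorname{proj}_{\operatorname{rge}A}b\|^2+\|x\|_1$ (equivalently of $\frac12\|Ax-b\|^2+\lambda\|x\|_1$); if $\lambda=0$, $S(0,b,A)$ is the set of minimizers of $\|x\|_1$ subject to $Ax=\operatorname{proj}_{\operatorname{rge}A}b$; if $\lambda<0$, $S(\lambda,b,A)=\emptyset$. Index partitions: $I=\{1,\dots,n\}$ and $\mathcal{I}$ is the set of all triples $(I^+,I^0,I^-)$ of pairwise disjoint (possibly empty) subsets of $I$ whose union is $I$. $\mathcal{J}(A)$ is the set of $(I^+,I^0,I^-)\in\mathcal{I}$ for which there is $y\in\mathbb{R}^m$ with $A_i^\top y=1$ for $i\in I^+$, $|A_i^\top y|<1$ for $i\in I^0$, $A_i^\top y=-1$ for $i\in I^-$. For $(I^+,I^0,I^-)\in\mathcal{I}$, $\mathbb{G}(A,(I^+,I^0,I^-))$ is the polyhedral cone of all $(\lambda,b,x)\in\mathbb{R}_+\times\mathbb{R}^m\times\mathbb{R}^n$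 such that $x_i\ge0,\ A_i^\top(b-Ax)=\lambda$ for $i\in I^+$; $x_i=0,\ |A_i^\top(b-Ax)|\le\lambda$ for $i\in I^0$; $x_i\le0,\ A_i^\top(b-Ax)=-\lambda$ for $i\in I^-$. $P_{1,2}$ is the projection $(\lambda,b,x)\mapsto(\lambda,b)$. A single-valued mapping is linear on a set $D$ if it coincides on $D$ with a linear map (of the form $z\mapsto Bz$ for a matrix $B$). *)

(* Defs.v *)
From HB Require Import structures.
From mathcomp Require Import all_boot all_order all_algebra.
From mathcomp Require Import all_classical all_reals all_analysis.

Set Implicit Arguments.
Unset Strict Implicit.
Unset Printing Implicit Defensive.

Import Order.TTheory GRing.Theory Num.Theory.
Import numFieldNormedType.Exports.

Local Open Scope classical_set_scope.
Local Open Scope ring_scope.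

(* The library norm on matrices is the sup norm; it induces the same topology
   as the Euclidean norm, so it is used below only for topological notions. *)
Definition norm2 (R : realType) (k : nat) (v : 'cV[R]_k) : R :=
  Num.sqrt (\sum_(i < k) v i 0 ^+ 2).

Definition norm1 (R : realType) (k : nat) (v : 'cV[R]_k) : R :=
  \sum_(i < k) `|v i 0|.

Definition argmin_on (R : realType) (T : Type) (D : set T) (f : T -> R) :
    set T :=
  [set x | D x /\ forall y, D y -> f x <= f y].

Definition rge (R : realType) (m n : nat) (A : 'M[R]_(m, n)) : set 'cV[R]_m :=
  range (fun x : 'cV[R]_n => A *m x).

(* The nearest point exists and is unique, so the default value 0 of [xget] is
   never used. *)
Definition proj_rge (R : realType) (m n : nat) (A : 'M[R]_(m, n))
    (b : 'cV[R]_m) : 'cV[R]_m :=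
  xget 0 (argmin_on (rge A) (fun p => norm2 (p - b))).

Definition solS (R : realType) (m n : nat) (lambda : R) (b : 'cV[R]_m)
    (A : 'M[R]_(m, n)) : set 'cV[R]_n :=
  if 0 < lambda then
    argmin_on setT (fun x =>
      (2 * lambda)^-1 * norm2 (A *m x - proj_rge A b) ^+ 2 + norm1 x)
  else if lambda == 0 then
    argmin_on [set x | A *m x = proj_rge A b] (@norm1 R n)
  else set0.

Definition coldot (R : realType) (m n : nat) (A : 'M[R]_(m, n)) (i : 'I_n)
    (y : 'cV[R]_m) : R :=
  ((col i A)^T *m y) 0 0.

Record signsets (n : nat) := SignSets {
  Ipos : {set 'I_n};
  Izer : {set 'I_n};
  Ineg : {set 'I_n} }.

Definition index_partition (n : nat) (T : signsets n) : Prop :=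
  [/\ Ipos T :&: Izer T = finset.set0, Ipos T :&: Ineg T = finset.set0,
      Izer T :&: Ineg T = finset.set0 &
      Ipos T :|: Izer T :|: Ineg T = finset.setT].

Definition in_J (R : realType) (m n : nat) (A : 'M[R]_(m, n))
    (T : signsets n) : Prop :=
  index_partition T /\
  exists y : 'cV[R]_m,
    [/\ forall i, i \in Ipos T -> coldot A i y = 1,
        forall i, i \in Izer T -> `|coldot A i y| < 1 &
        forall i, i \in Ineg T -> coldot A i y = -1].

Definition coneG (R : realType) (m n : nat) (A : 'M[R]_(m, n))
    (T : signsets n) : set (R * 'cV[R]_m * 'cV[R]_n) :=
  [set lbx : R * 'cV[R]_m * 'cV[R]_n | let: (lambda, b, x) := lbx in
    [/\ 0 <= lambda,
        forall i, i \in Ipos T ->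
          0 <= x i 0 /\ coldot A i (b - A *m x) = lambda,
        forall i, i \in Izer T ->
          x i 0 = 0 /\ `|coldot A i (b - A *m x)| <= lambda &
        forall i, i \in Ineg T ->
          x i 0 <= 0 /\ coldot A i (b - A *m x) = - lambda]].

Definition projG (R : realType) (m n : nat) (A : 'M[R]_(m, n))
    (T : signsets n) : set (R * 'cV[R]_m) :=
  [set lbx.1 | lbx in coneG A T].

(* C^k on an open set U, for V finite-dimensional: continuity of x |-> 'D_v f x
   for every v is then continuity of the differential in operator norm. *)
Fixpoint Ck_on (R : realType) (V W : normedModType R) (k : nat) (U : set V)
    (f : V -> W) : Prop :=
  match k with
  | 0%N => forall x, U x -> {for x, continuous f}
  | k'.+1 => (forall x, U x -> differentiable f x) /\
             (forall v : V, Ck_on k' U ('D_v f))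
  end.

Definition smooth_on (R : realType) (V W : normedModType R) (U : set V)
    (f : V -> W) : Prop :=
  forall k, Ck_on k U f.

Definition smooth_around (R : realType) (V W : normedModType R)
    (F : V -> set W) (z0 : V) : Prop :=
  exists U : set V, [/\ open U, U z0 &
    exists2 f : V -> W, (forall z, U z -> F z = [set f z]) & smooth_on U f].

Definition linear_on (R : realType) (V W : lmodType R) (F : V -> set W)
    (D : set V) : Prop :=
  exists L : {linear V -> W}, forall z, D z -> F z = [set L z].

Definition condition13 (R : realType) (m n : nat) (lambda : R)
    (b : 'cV[R]_m) (A : 'M[R]_(m, n)) : Prop :=
  exists x : 'cV[R]_n,
    [/\ solS lambda b A x,
        free [seq col i A | i <- enum 'I_n & x i 0 != 0] &
        forall i, x i 0 = 0 -> `|coldot A i (b - A *m x)| < lambda].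

(* Main.v *)
Require Import Defs.
From HB Require Import structures.
From mathcomp Require Import all_boot all_order all_algebra.
From mathcomp Require Import all_classical all_reals all_analysis.
From mathcomp Require Import ring lra.

Set Implicit Arguments.
Unset Strict Implicit.
Unset Printing Implicit Defensive.

Import Order.TTheory GRing.Theory Num.Theory.
Import numFieldNormedType.Exports.

Local Open Scope classical_set_scope.
Local Open Scope ring_scope.

(** For [lambda > 0] the solutions are the vectors [x] with
[A^T (b - A x) \in lambda * d|x|_1] ([solS_kkt]), and all of them have the same
residual ([kkt_fit]).

Suppose the strict condition holds at [x]. Fix the signs of [x] and keep only
the equality part of the optimality conditions. Since the active columns are
independent, this is an invertible linear system; its solution [branch x] is a
rational function of [(lambda, b, A)] which is linear in [(lambda, b)]. The
remaining conditions are strict inequalities, so by continuity [branch x] keeps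
satisfying them nearby ([nbhs_strict_region]), and there it is the only
solution. This yields smoothness, and shows that [(lambda, b)] is interior to
the cone of the signs of [x]. On that whole cone, boundary and [lambda = 0]
included, the normalized residual of [x] is a dual certificate making the
solution unique ([solS_coneG]), so the solution map is linear there. No other
sign pattern can describe [x], by strictness ([coneG_strict_signs]).

Conversely, both smoothness and linearity on a cone around [(lambda, b)] provide
single-valued solutions that are differentiable along each line [b + t *: v]. A
dependence between active columns would destroy uniqueness
([solS_unique_free]), and a tight inactive constraint would produce a kink along
a suitable line ([condition13_of_curves]). Hence smoothness gives back the
strict condition, from which linearity on the cone is obtained, and linearity
closes the cycle. *)

(** * The Euclidean inner product *)

Definition dot (R : realType) (k : nat) (u v : 'cV[R]_k) : R := (u^T *m v) 0 0.

Lemma dotE (R : realType) k (u v : 'cV[R]_k) : dot u v = \sum_i u i 0 * v i 0.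
Proof. by rewrite /dot mxE; apply: eq_bigr => i _; rewrite mxE. Qed.

Lemma dotC (R : realType) k (u v : 'cV[R]_k) : dot u v = dot v u.
Proof. by rewrite !dotE; apply: eq_bigr => i _; rewrite mulrC. Qed.

Lemma dotDr (R : realType) k (u v w : 'cV[R]_k) :
  dot u (v + w) = dot u v + dot u w.
Proof. by rewrite /dot mulmxDr mxE. Qed.

Lemma dotNr (R : realType) k (u v : 'cV[R]_k) : dot u (- v) = - dot u v.
Proof. by rewrite /dot mulmxN mxE. Qed.

Lemma dotZr (R : realType) k (u v : 'cV[R]_k) a :
  dot u (a *: v) = a * dot u v.
Proof. by rewrite /dot -scalemxAr mxE. Qed.

Lemma dotDl (R : realType) k (u v w : 'cV[R]_k) :
  dot (v + w) u = dot v u + dot w u.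
Proof. by rewrite dotC dotDr !(dotC u). Qed.

Lemma dotNl (R : realType) k (u v : 'cV[R]_k) : dot (- v) u = - dot v u.
Proof. by rewrite dotC dotNr dotC. Qed.

Lemma dotZl (R : realType) k (u v : 'cV[R]_k) a :
  dot (a *: v) u = a * dot v u.
Proof. by rewrite dotC dotZr dotC. Qed.

Lemma dot_mulmxr (R : realType) m n (A : 'M[R]_(m, n)) u v :
  dot u (A *m v) = dot (A^T *m u) v.
Proof. by rewrite /dot mulmxA trmx_mul trmxK. Qed.

Lemma dot_ge0 (R : realType) k (u : 'cV[R]_k) : 0 <= dot u u.
Proof. by rewrite dotE sumr_ge0// => i _; rewrite -expr2 sqr_ge0. Qed.

Lemma dot_eq0 (R : realType) k (u : 'cV[R]_k) : dot u u = 0 -> u = 0.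
Proof.
rewrite dotE => /eqP; rewrite psumr_eq0; last first.
  by move=> i _; rewrite -expr2 sqr_ge0.
move=> /allP h; apply/colP => i; rewrite mxE.
have /= := h i; rewrite mem_index_enum => /(_ isT).
by rewrite -expr2 sqrf_eq0 => /eqP.
Qed.

Lemma norm2_sqr (R : realType) k (u : 'cV[R]_k) : norm2 u ^+ 2 = dot u u.
Proof.
rewrite /norm2 sqr_sqrtr ?dotE; first by apply: eq_bigr => i _; rewrite expr2.
by rewrite sumr_ge0// => i _; rewrite sqr_ge0.
Qed.

Lemma coldotE (R : realType) m n (A : 'M[R]_(m, n)) i y :
  coldot A i y = (A^T *m y) i 0.
Proof. by rewrite /coldot !mxE; apply: eq_bigr => j _; rewrite !mxE. Qed.

Lemma sum_coldot (R : realType) m n (A : 'M[R]_(m, n)) y (x : 'cV[R]_n) :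
  \sum_i coldot A i y * x i 0 = dot y (A *m x).
Proof.
by rewrite dot_mulmxr dotE; apply: eq_bigr => i _; rewrite coldotE.
Qed.

Lemma coldotD (R : realType) m n (A : 'M[R]_(m, n)) i y z :
  coldot A i (y + z) = coldot A i y + coldot A i z.
Proof. by rewrite !coldotE mulmxDr mxE. Qed.

Lemma coldotN (R : realType) m n (A : 'M[R]_(m, n)) i y :
  coldot A i (- y) = - coldot A i y.
Proof. by rewrite !coldotE mulmxN mxE. Qed.

Lemma coldotZ (R : realType) m n (A : 'M[R]_(m, n)) i a y :
  coldot A i (a *: y) = a * coldot A i y.
Proof. by rewrite !coldotE -scalemxAr mxE. Qed.

(** * Least squares and optimality conditions *)

(** Solvability over any real field: a row combination killed by [A^T A] is
killed by [A], since [(A N)^T (A N) = 0] forces [A N = 0], so [b^T A] lies in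
the row space of [A^T A]. *)
Lemma normal_equation (R : realType) m n (A : 'M[R]_(m, n)) (b : 'cV[R]_m) :
  exists x : 'cV[R]_n, A^T *m (A *m x - b) = 0.
Proof.
have : (b^T *m A <= A^T *m A)%MS.
  rewrite submxE; set N := cokermx _.
  have AN0 : A *m N = 0.
    have h : (A *m N)^T *m (A *m N) = 0.
      by rewrite trmx_mul -mulmxA (mulmxA A^T) mulmx_coker mulmx0.
    apply/matrixP => i j.
    have /colP/(_ i) : col j (A *m N) = 0.
      apply: dot_eq0; rewrite /dot.
      have -> : (col j (A *m N))^T *m col j (A *m N) =
        row j ((A *m N)^T) *m col j (A *m N) by rewrite tr_col.
      rewrite -!row_mul colE mulmxA.
      by rewrite h mul0mx row0 mxE.
    by rewrite !mxE.
  by rewrite -mulmxA AN0 mulmx0.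
move=> /submxP[D hD]; exists D^T.
rewrite mulmxBr mulmxA; apply/eqP; rewrite subr_eq0; apply/eqP.
apply: trmx_inj; rewrite !trmx_mul !trmxK -hD.
by [].
Qed.

(** The normal equations make the residual orthogonal to the range, so by
Pythagoras every other point of the range is strictly farther from [b]. *)
Lemma proj_rgeE (R : realType) m n (A : 'M[R]_(m, n)) (b : 'cV[R]_m) x :
  A^T *m (A *m x - b) = 0 -> proj_rge A b = A *m x.
Proof.
move=> hx.
have pyth y : norm2 (A *m y - b) ^+ 2 =
    norm2 (A *m x - b) ^+ 2 + dot (A *m (y - x)) (A *m (y - x)).
  have -> : A *m y - b = A *m x - b + A *m (y - x).
    by rewrite mulmxBr [RHS]addrC subrKA.
  have h0 : dot (A *m x - b) (A *m (y - x)) = 0.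
    by rewrite dot_mulmxr hx /dot trmx0 mul0mx mxE.
  rewrite !norm2_sqr; move: (A *m x - b) (A *m (y - x)) h0 => p q h0.
  by rewrite dotDr !dotDl (dotC q p) h0 add0r addr0.
have n0 k (u : 'cV[R]_k) : 0 <= norm2 u by rewrite sqrtr_ge0.
have hmin : argmin_on (rge A) (fun p => norm2 (p - b)) (A *m x).
  split=> [|_ [y _ <-]]; first by exists x.
  rewrite -(@ler_pXn2r _ 2) ?nnegrE// (pyth y) lerDl; exact: dot_ge0.
have := xgetI 0 hmin; rewrite -/(proj_rge A b).
move=> -[[y _ <-]] /(_ (A *m x)) /(_ (ex_intro2 _ _ x I erefl)).
rewrite -(@ler_pXn2r _ 2) ?nnegrE// (pyth y) gerDl => h.
have /dot_eq0 : dot (A *m (y - x)) (A *m (y - x)) = 0.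
  by apply/eqP; rewrite eq_le h dot_ge0.
by rewrite mulmxBr => /eqP; rewrite subr_eq0 => /eqP.
Qed.

(** The subdifferential inclusion [A^T (b - A x) \in lambda * d|x|_1], written
without case distinction on the signs of the entries: a vector [r] lies in
[lambda * d|x|_1] iff [|r_i| <= lambda] and [r_i x_i = lambda |x_i|]. *)
Definition kkt (R : realType) m n (lambda : R) (b : 'cV[R]_m)
    (A : 'M[R]_(m, n)) (x : 'cV[R]_n) : Prop :=
  forall i, `|coldot A i (b - A *m x)| <= lambda /\
            coldot A i (b - A *m x) * x i 0 = lambda * `|x i 0|.

(** A derivative at [0] in disguise: divide by [t] and let [t] tend to [0]. The
proof needs only one step, [t = a / (|c| + a + 1)]. *)
Lemma le0_of_scaled_le (R : realType) (a c : R) :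
  (forall t, 0 < t -> t <= 1 -> t * a <= t ^+ 2 * c) -> a <= 0.
Proof.
move=> h; rewrite leNgt; apply/negP => a0.
set d := `|c| + a + 1.
have d0 : 0 < d by rewrite /d; have := normr_ge0 c; lra.
have t0 : 0 < a / d by rewrite divr_gt0.
have t1 : a / d <= 1.
  by rewrite ler_pdivrMr// mul1r /d; have := normr_ge0 c; lra.
have := h _ t0 t1; rewrite expr2 -mulrA ler_pM2l// => h1.
have : a / d * c <= a / d * `|c| by rewrite ler_pM2l// ler_norm.
move=> /(le_trans h1); rewrite mulrAC ler_pdivlMr// ler_pM2l// /d; lra.
Qed.

(** Sufficiency is convexity. For necessity only perturbations of one
coordinate are used: along [x + t u e_i] the objective changes by a quadratic
term in [t] plus a convex term, and letting [t] tend to [0] leaves the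
variational inequality [r_i u <= lambda (|x_i + u| - |x_i|)] for all [u]. *)
Lemma solS_kkt (R : realType) m n (lambda : R) (b : 'cV[R]_m)
    (A : 'M[R]_(m, n)) x :
  0 < lambda -> solS lambda b A x <-> kkt lambda b A x.
Proof.
move=> l0; rewrite /solS l0.
have [x0 hx0] := normal_equation A b; rewrite (proj_rgeE hx0).
set obj := (fun x : 'cV[R]_n => _).
set r := b - A *m x.
(* Second-order expansion at [x]; the projection of [b] enters only through
   [A^T], hence can be replaced by [b] in the linear term. *)
have objE y : lambda * (obj y - obj x) =
    lambda * (norm1 y - norm1 x) - dot (A^T *m r) (y - x)
    + 2^-1 * dot (A *m (y - x)) (A *m (y - x)).
  rewrite /obj !norm2_sqr.
  have -> : A *m y - A *m x0 = A *m x - A *m x0 + A *m (y - x).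
    by rewrite mulmxBr [RHS]addrC subrKA.
  have -> : dot (A^T *m r) (y - x) = - dot (A *m x - A *m x0) (A *m (y - x)).
    have -> : r = - (A *m x - A *m x0) - (A *m x0 - b).
      by rewrite !opprB [RHS]addrC subrKA.
    by rewrite mulmxBr hx0 subr0 mulmxN dotNl dot_mulmxr.
  move: (A *m x - A *m x0) (A *m (y - x)) => p q.
  rewrite dotDr !dotDl (dotC q p) invfM; field.
  exact: lt0r_neq0.
have rE i : (A^T *m r) i 0 = coldot A i r by rewrite coldotE.
split=> [[_ xmin] | hk].
  have vi i u : coldot A i r * u <= lambda * (`|x i 0 + u| - `|x i 0|).
    set e : 'cV[R]_n := u *: delta_mx i 0.
    set c := 2^-1 * dot (A *m e) (A *m e).
    rewrite -subr_le0; apply: (@le0_of_scaled_le _ _ c) => t t0 t1.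
    have : 0 <= lambda * (obj (x + t *: e) - obj x).
      by rewrite pmulr_rge0// subr_ge0; exact: xmin.
    rewrite objE.
    have -> : x + t *: e - x = t *: e by rewrite addrC addKr.
    rewrite -scalemxAr (dotZr (A^T *m r) e) (dotZr _ (A *m e)) dotZl.
    have -> : dot (A^T *m r) e = coldot A i r * u.
      rewrite dotE (bigD1 i)//= big1 ?addr0 => [|j ji].
        by rewrite rE !mxE !eqxx mulr1.
      by rewrite !mxE (negPf ji) !mulr0.
    have -> : norm1 (x + t *: e) - norm1 x = `|x i 0 + t * u| - `|x i 0|.
      rewrite /norm1 -sumrB (bigD1 i)//= big1 ?addr0 => [|j ji].
        by rewrite !mxE !eqxx !mulr1.
      by rewrite !mxE (negPf ji) !mulr0 addr0 subrr.
    have conv : `|x i 0 + t * u| <= (1 - t) * `|x i 0| + t * `|x i 0 + u|.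
      have -> : x i 0 + t * u = (1 - t) * x i 0 + t * (x i 0 + u) by ring.
      rewrite (le_trans (ler_normD _ _))// !normrM (gtr0_norm t0).
      by rewrite ger0_norm// subr_ge0.
    move=> ge0.
    have : lambda * `|x i 0 + t * u| <=
      lambda * ((1 - t) * `|x i 0| + t * `|x i 0 + u|) by rewrite ler_pM2l.
    rewrite /c expr2; move: ge0.
    set q := dot _ _; set p := coldot _ _ _; set z := `|x i 0 + t * u|.
    set w := `|x i 0 + u|; set v := `|x i 0|.
    nra.
  have bd i : `|coldot A i r| <= lambda.
    have key u : coldot A i r * u <= lambda * `|u|.
      apply: (le_trans (vi i u)); rewrite ler_pM2l// lerBlDr addrC.
      exact: ler_normD.
    have := key (-1); have := key 1; rewrite normrN normr1 mulrN !mulr1.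
    by rewrite ler_norml => -> /=; rewrite lerNl => ->.
  (* [u = - x_i] gives the missing inequality of complementarity. *)
move=> i; split=> //; apply/eqP; rewrite eq_le; apply/andP; split.
    rewrite (le_trans (ler_norm _))// normrM.
    by rewrite ler_wpM2r.
  have := vi i (- x i 0); rewrite subrr normr0 sub0r mulrN mulrN.
  by rewrite lerN2.
split=> // y _; rewrite -subr_ge0 -(pmulr_rge0 _ l0) objE.
have hx : dot (A^T *m r) x = lambda * norm1 x.
  rewrite dotE /norm1 mulr_sumr; apply: eq_bigr => i _; rewrite rE.
  by have [_] := hk i.
have hy : dot (A^T *m r) y <= lambda * norm1 y.
  rewrite dotE /norm1 mulr_sumr; apply: ler_sum => i _; rewrite rE.
  rewrite (le_trans (ler_norm _))// normrM ler_wpM2r//.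
  by have [] := hk i.
rewrite dotDr dotNr hx.
have := dot_ge0 (A *m (y - x)); lra.
Qed.

(** Monotonicity of the subdifferential: [|A (x - y)|^2] equals minus the
pairing of [x - y] with the difference of the two subgradients, and that
pairing is nonnegative. Hence all minimizers share the same residual. *)
Lemma kkt_fit (R : realType) m n (lambda : R) (b : 'cV[R]_m)
    (A : 'M[R]_(m, n)) x y :
  kkt lambda b A x -> kkt lambda b A y -> A *m x = A *m y.
Proof.
move=> hx hy; apply/eqP; rewrite -subr_eq0 -mulmxBr; apply/eqP/dot_eq0.
apply/eqP; rewrite eq_le dot_ge0 andbT.
have -> : dot (A *m (x - y)) (A *m (x - y)) =
    \sum_i (coldot A i (b - A *m y) - coldot A i (b - A *m x)) *
      (x i 0 - y i 0).
  transitivity (\sum_i coldot A i (A *m (x - y)) * (x - y) i 0).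
    by rewrite sum_coldot.
  apply: eq_bigr => i _; rewrite -coldotN -coldotD !mxE.
  congr (coldot _ _ _ * _).
  by rewrite mulmxBr opprB [b + _]addrC addrACA subrr addr0 addrC.
apply: sumr_le0 => i _.
have [bx ex] := hx i; have [by' ey] := hy i.
have h1 : coldot A i (b - A *m y) * x i 0 <= lambda * `|x i 0|.
  by rewrite (le_trans (ler_norm _))// normrM ler_wpM2r.
have h2 : coldot A i (b - A *m x) * y i 0 <= lambda * `|y i 0|.
  by rewrite (le_trans (ler_norm _))// normrM ler_wpM2r.
nra.
Qed.

Lemma kkt_norm1 (R : realType) m n (lambda : R) (b : 'cV[R]_m)
    (A : 'M[R]_(m, n)) x :
  kkt lambda b A x -> dot (b - A *m x) (A *m x) = lambda * norm1 x.
Proof.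
move=> hx; rewrite -sum_coldot /norm1 mulr_sumr.
by apply: eq_bigr => i _; have [] := hx i.
Qed.

(** * Smooth maps and their algebra *)

Lemma CkS (R : realType) (V W : normedModType R) k (U : set V) (f : V -> W) :
  Ck_on k.+1 U f -> Ck_on k U f.
Proof.
elim: k f => [|k IH] f [df Df] /=.
  by move=> x Ux; apply/differentiable_continuous/df.
by split=> // v; apply: IH; exact: Df.
Qed.

Lemma Ck_sub (R : realType) (V W : normedModType R) k (U U' : set V)
    (f : V -> W) : U' `<=` U -> Ck_on k U f -> Ck_on k U' f.
Proof.
move=> sub; elim: k f => [|k IH] f /=.
  by move=> fU x /sub; exact: fU.
by move=> [df Df]; split=> [x /sub|v]; [exact: df|exact: IH].
Qed.

(** Differentiability is local. The differential is a chosen linear map, so it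
is first transported through its uniqueness. *)
Lemma near_differentiable (R : realType) (V W : normedModType R)
    (f g : V -> W) x : (\forall y \near x, f y = g y) ->
  differentiable f x -> differentiable g x.
Proof.
move=> fg /diff_locallyP [dfc /eqaddoP fE].
have gE : g \o shift x = cst (g x) + 'd f x +o_ 0 id.
  apply/eqaddoP => e e0; have fgx := nbhs_singleton fg.
  have fg0 : \forall h \near (0 : V), f (h + x) = g (h + x).
    by move: fg; rewrite (near_shift 0) /= subr0.
  apply: filterS2 fg0 (fE e e0) => h fgh.
  by rewrite !fctE /= fgh fgx.
apply/diff_locallyP; have dg := diff_unique dfc gE.
by split; rewrite dg.
Qed.

(** Being [C^k] on an open set depends only on the values there; this allows
derivatives, which are identified only on [U], to be replaced by formulas. *)
Lemma Ck_eq (R : realType) (V W : normedModType R) k (U : set V)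
    (f g : V -> W) : open U -> (forall x, U x -> f x = g x) ->
  Ck_on k U f -> Ck_on k U g.
Proof.
move=> oU; elim: k f g => [|k IH] f g fg /=.
  move=> fU x Ux; have fgx : \near x, f x = g x.
    by apply: filterS (open_nbhs_nbhs (conj oU Ux)) => y; exact: fg.
  change (g @ x --> g x); rewrite -(fg _ Ux).
  by apply: cvg_trans (fU x Ux); exact: near_eq_cvg.
move=> [df Df]; split=> [x Ux|v].
  have fgx : \near x, f x = g x.
    by apply: filterS (open_nbhs_nbhs (conj oU Ux)) => y; exact: fg.
  exact: (near_differentiable fgx (df x Ux)).
apply: IH (Df v) => x Ux; apply: near_eq_derive.
by apply: filterS (open_nbhs_nbhs (conj oU Ux)) => y; exact: fg.
Qed.

Lemma smooth_cst (R : realType) (V W : normedModType R) (U : set V) (c : W) :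
  smooth_on U (cst c : V -> W).
Proof.
move=> k; elim: k c => [|k IH] c /=; first by move=> x _; exact: cst_continuous.
split=> [x _|v]; first exact: differentiable_cst.
rewrite (_ : 'D_v (cst c) = cst 0); first exact: IH.
by apply/funext => x; rewrite derive_cst.
Qed.

Lemma smooth_linear (R : realType) (V W : normedModType R) (U : set V)
  (f : {linear V -> W}) : continuous f -> smooth_on U f.
Proof.
move=> fc [|k] /=; first by move=> x _; exact: fc.
split=> [x _|v]; first exact: linear_differentiable.
rewrite (_ : 'D_v f = cst (f v)); first exact: smooth_cst.
apply/funext => x; rewrite deriveE; last exact: linear_differentiable.
by rewrite diff_lin.
Qed.

Lemma CkD (R : realType) (V W : normedModType R) k (U : set V)
  (f g : V -> W) : open U -> Ck_on k U f -> Ck_on k U g -> Ck_on k U (f + g).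
Proof.
move=> oU; elim: k f g => [|k IH] f g /=.
  by move=> fU gU x Ux; apply: continuousD; [exact: fU|exact: gU].
move=> [df Df] [dg Dg]; split=> [x Ux|v].
  by apply: differentiableD; [exact: df|exact: dg].
apply: (Ck_eq oU _ (IH _ _ (Df v) (Dg v))) => x Ux.
by rewrite deriveD//; apply: diff_derivable; [exact: df|exact: dg].
Qed.

(** Leibniz rule: the derivative of a product only involves products of [C^k]
functions, [f] and [g] themselves being [C^k] because they are [C^k.+1]. *)
Lemma CkM (R : realType) (V : normedModType R) k (U : set V)
  (f g : V -> R) : open U -> Ck_on k U f -> Ck_on k U g -> Ck_on k U (f * g).
Proof.
move=> oU; elim: k f g => [|k IH] f g.
  by move=> fU gU x Ux; apply: continuousM; [exact: fU|exact: gU].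
move=> fk gk; have fk' := CkS fk; have gk' := CkS gk.
case: fk gk => [df Df] [dg Dg]; split=> [x Ux|v].
  by apply: differentiableM; [exact: df|exact: dg].
apply: (Ck_eq oU _ (CkD oU (IH _ _ fk' (Dg v)) (IH _ _ gk' (Df v)))) => x Ux.
by rewrite deriveM//; apply: diff_derivable; [exact: df|exact: dg].
Qed.

(** The derivative [- f^-2 * f'] contains [f^-1] again, which the induction
hypothesis already makes [C^k]. *)
Lemma CkV (R : realType) (V : normedModType R) k (U : set V)
  (f : V -> R) : open U -> (forall x, U x -> f x != 0) ->
  Ck_on k U f -> Ck_on k U (fun x => (f x)^-1).
Proof.
move=> oU f0; elim: k => [|k IH].
  by move=> fU x Ux; apply: continuousV; [exact: f0|exact: fU].
move=> fk; have fV := IH (CkS fk); case: fk => [df Df].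
split=> [x Ux|v].
  by apply: differentiableV; [exact: df|exact: f0].
have c1 : Ck_on k U (cst (-1) : V -> R) by exact: smooth_cst.
apply: (Ck_eq oU _ (CkM oU c1 (CkM oU (CkM oU fV fV) (Df v)))) => x Ux.
rewrite deriveV//; last 2 first.
- exact: f0.
- by apply: diff_derivable; exact: df.
by rewrite -[RHS]/(_ * _) !fctE expr2 invfM mulN1r mulNr.
Qed.

Lemma CkZl (R : realType) (V W : normedModType R) k (U : set V)
  (f : V -> R) (w : W) : open U -> Ck_on k U f ->
  Ck_on k U (fun x => f x *: w).
Proof.
move=> oU; elim: k f => [|k IH] f.
  move=> fU x Ux; apply: cvgZr_tmp; exact: fU.
move=> [df Df]; split=> [x Ux|v].
  by apply: differentiableZl; exact: df.
apply: (Ck_eq oU _ (IH _ (Df v))) => x Ux.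
have dfx := df x Ux.
by rewrite deriveE// [RHS]deriveE ?diffZl//; exact: differentiableZl.
Qed.

Lemma smooth_sum (R : realType) (V W : normedModType R) (U : set V)
    (I : Type) (r : seq I) (P : pred I) (F : I -> V -> W) : open U ->
  (forall i, P i -> smooth_on U (F i)) ->
  smooth_on U (fun x => \sum_(i <- r | P i) F i x).
Proof.
move=> oU FU k.
rewrite -[X in Ck_on _ _ X]fct_sumE.
apply: (big_ind (Ck_on k U)) => [|f g|i Pi].
- exact: smooth_cst.
- exact: CkD.
- exact: FU.
Qed.

Lemma smooth_prod (R : realType) (V : normedModType R) (U : set V)
    (I : Type) (r : seq I) (P : pred I) (F : I -> V -> R) : open U ->
  (forall i, P i -> smooth_on U (F i)) ->
  smooth_on U (fun x => \prod_(i <- r | P i) F i x).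
Proof.
move=> oU FU k.
rewrite -[X in Ck_on _ _ X]fct_prodE.
apply: (big_ind (Ck_on k U)) => [|f g|i Pi].
- exact: smooth_cst.
- exact: CkM.
- exact: FU.
Qed.

(** Entrywise smoothness, the form in which determinants and adjugates, that is
polynomials in the entries, can be treated. *)
Definition smooth_mx (R : realType) (V : normedModType R) (U : set V) m n
    (M : V -> 'M[R]_(m, n)) : Prop :=
  forall i j, smooth_on U (fun z => M z i j).

Lemma smooth_mx_cst (R : realType) (V : normedModType R) (U : set V) m n
    (M : 'M[R]_(m, n)) : smooth_mx U (fun _ => M).
Proof. by move=> i j; exact: smooth_cst. Qed.

Lemma smooth_mxD (R : realType) (V : normedModType R) (U : set V) m n
    (M N : V -> 'M[R]_(m, n)) : open U ->
  smooth_mx U M -> smooth_mx U N -> smooth_mx U (fun z => M z + N z).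
Proof.
move=> oU MU NU i j k; under eq_fun do rewrite mxE.
by apply: CkD => //; [exact: MU|exact: NU].
Qed.

Lemma smooth_mxZ (R : realType) (V : normedModType R) (U : set V) m n
    (a : V -> R) (N : V -> 'M[R]_(m, n)) : open U ->
  smooth_on U a -> smooth_mx U N -> smooth_mx U (fun z => a z *: N z).
Proof.
move=> oU aU NU i j k; under eq_fun do rewrite mxE.
by apply: CkM => //; exact: NU.
Qed.

Lemma smooth_mxT (R : realType) (V : normedModType R) (U : set V) m n
    (M : V -> 'M[R]_(m, n)) : smooth_mx U M -> smooth_mx U (fun z => (M z)^T).
Proof. by move=> MU i j k; under eq_fun do rewrite mxE; exact: MU. Qed.

Lemma smooth_mxM (R : realType) (V : normedModType R) (U : set V) m n p
    (M : V -> 'M[R]_(m, n)) (N : V -> 'M[R]_(n, p)) : open U ->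
  smooth_mx U M -> smooth_mx U N -> smooth_mx U (fun z => M z *m N z).
Proof.
move=> oU MU NU i j; under eq_fun do rewrite mxE.
apply: smooth_sum => // l _ k; apply: CkM => //; [exact: MU|exact: NU].
Qed.

Lemma smooth_det (R : realType) (V : normedModType R) (U : set V) n
    (M : V -> 'M[R]_n) : open U ->
  smooth_mx U M -> smooth_on U (fun z => \det (M z)).
Proof.
move=> oU MU; apply: smooth_sum => // s _ k; apply: CkM => //.
  exact: smooth_cst.
by apply: smooth_prod => // i _; exact: MU.
Qed.

Lemma smooth_adj (R : realType) (V : normedModType R) (U : set V) n
    (M : V -> 'M[R]_n) : open U ->
  smooth_mx U M -> smooth_mx U (fun z => \adj (M z)).
Proof.
move=> oU MU i j k; under eq_fun do rewrite mxE.
apply: CkM => //; first exact: smooth_cst.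
apply: smooth_det => // i' j'.
by under eq_fun do rewrite !mxE; exact: MU.
Qed.

(** Cramer's rule. *)
Lemma smooth_invmx (R : realType) (V : normedModType R) (U : set V) n
    (M : V -> 'M[R]_n) : open U -> (forall z, U z -> M z \in unitmx) ->
  smooth_mx U M -> smooth_mx U (fun z => invmx (M z)).
Proof.
move=> oU unitM MU i j k.
have h : Ck_on k U (fun z => ((\det (M z))^-1 *: \adj (M z)) i j).
  apply: (smooth_mxZ oU _ (smooth_adj oU MU)) => l.
  apply: CkV => // [z /unitM|]; first by rewrite unitmxE unitfE.
  exact: smooth_det.
by apply: Ck_eq oU _ h => z /unitM Mz; rewrite /invmx Mz.
Qed.

Lemma smooth_of_mx (R : realType) (V : normedModType R) (U : set V) n
    (f : V -> 'cV[R]_n) : open U -> smooth_mx U f -> smooth_on U f.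
Proof.
move=> oU fU k.
have h : Ck_on k U (fun z => \sum_i f z i 0 *: (delta_mx i 0 : 'cV[R]_n)).
  by apply: smooth_sum => // i _ l; apply: CkZl => //; exact: fU.
by apply: Ck_eq oU _ h => z _; rewrite {2}(matrix_sum_delta (f z));
  apply: eq_bigr => i _; rewrite big_ord1.
Qed.

(** * The linear system of a sign pattern *)

(** Linear independence of the columns of [A] indexed by the support of [x0],
expressed with full-length vectors to avoid submatrices. *)
Definition active_inj (R : realType) m n (A : 'M[R]_(m, n)) (x0 : 'cV[R]_n) :=
  forall h : 'cV[R]_n,
    (forall i, x0 i 0 = 0 -> h i 0 = 0) -> A *m h = 0 -> h = 0.

(** Coefficients of a combination of the selected columns are indexed by
positions in a list; they are exchanged with vectors supported on [x0] through
the position of an index in the list [s] of the support. *)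
Lemma free_active (R : realType) m n (A : 'M[R]_(m, n)) (x0 : 'cV[R]_n) :
  free [seq col i A | i <- enum 'I_n & x0 i 0 != 0] <-> active_inj A x0.
Proof.
set s := [seq i <- enum 'I_n | x0 i 0 != 0].
have us : uniq s by rewrite filter_uniq// enum_uniq.
have mems i : (i \in s) = (x0 i 0 != 0) by rewrite mem_filter mem_enum andbT.
have mulE (h : 'cV[R]_n) : (forall i, x0 i 0 = 0 -> h i 0 = 0) ->
    A *m h = \sum_(i <- s) h i 0 *: col i A.
  move=> h0; transitivity (\sum_(i < n) h i 0 *: col i A).
    apply/colP => j; rewrite !mxE summxE.
    by apply: eq_bigr => i _; rewrite !mxE mulrC.
  rewrite /s big_filter big_enum_cond [RHS]big_mkcond /=; apply: eq_bigr => i _.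
  by case: eqP => //= /h0 ->; rewrite scale0r.
have sumE (k : 'I_n -> R) : \sum_(i <- s) k i *: col i A =
    \sum_(j < size [seq col i A | i <- s])
      k (tnth (in_tuple s) (cast_ord (size_map _ _) j)) *:
      [seq col i A | i <- s]`_j.
  rewrite (big_tnth _ _ s) /=.
  rewrite (reindex (cast_ord (size_map (fun i => col i A) s))) /=; last first.
    by exists (cast_ord (esym (size_map (fun i => col i A) s))) => j _;
      rewrite ?cast_ordK ?cast_ordKV.
  apply: eq_bigr => j _; congr (_ *: _).
  set i := tnth _ _; rewrite (nth_map i); last first.
    by rewrite -(size_map (fun i => col i A)).
  by congr (col _ _); exact: tnth_nth.
split=> [/(@freeP _ _ _ (in_tuple _)) fr h h0 Ah | inj].
  apply/colP => i; rewrite mxE; apply: contrapT => /eqP hi.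
  have is_ : i \in s.
    by rewrite mems; apply/eqP => /h0 /eqP; rewrite (negPf hi).
  move: Ah; rewrite (mulE _ h0) (sumE (fun i => h i 0)) => /fr h1.
  have lt : (index i s < size [seq col i A | i <- s])%N.
    by rewrite size_map index_mem.
  have := h1 (Ordinal lt); rewrite (tnth_nth i) /= nth_index// => hi0.
  by rewrite hi0 eqxx in hi.
apply/(@freeP _ _ _ (in_tuple _)) => k hk j.
have szj : (j < size s)%N by rewrite -(size_map (fun i => col i A)).
pose kk (i : 'I_n) : R :=
  if insub (index i s) is Some l then k l else 0.
have kkE l : kk (tnth (in_tuple s) (cast_ord (size_map _ _) l)) = k l.
  rewrite /kk; set i := tnth _ _.
  have -> : index i s = l.
    by rewrite /i (tnth_nth i) /= index_uniq// -(size_map (fun i => col i A)).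
  by rewrite insubT//= => lt; congr k; apply: val_inj.
pose h : 'cV[R]_n := \col_i if i \in s then kk i else 0.
have h0 i : x0 i 0 = 0 -> h i 0 = 0.
  by move=> xi; rewrite mxE mems xi eqxx.
have hs : A *m h = 0.
  rewrite mulE// (eq_big_seq (fun i => kk i *: col i A)) => [|i is_]; last first.
    by rewrite mxE is_.
  by rewrite sumE -[RHS]hk; apply: eq_bigr => l _; rewrite kkE.
rewrite -kkE; set i := tnth _ _.
have is_ : i \in s by exact: mem_tnth.
by have /colP/(_ i) := inj h h0 hs; rewrite !mxE is_.
Qed.

Definition active_mx (R : realType) n (x0 : 'cV[R]_n) : 'M[R]_n :=
  diag_mx (\row_i (x0 i 0 != 0)%:R).

(** The Gram matrix of the active columns, padded with an identity block on the
inactive coordinates so that its size does not depend on the support. *)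
Definition kkt_mx (R : realType) m n (x0 : 'cV[R]_n) (A : 'M[R]_(m, n)) :
    'M[R]_n :=
  active_mx x0 *m A^T *m A *m active_mx x0 + (1%:M - active_mx x0).

Definition kkt_rhs (R : realType) m n (x0 : 'cV[R]_n) (l : R) (b : 'cV[R]_m)
    (A : 'M[R]_(m, n)) : 'cV[R]_n :=
  active_mx x0 *m A^T *m b - l *: map_mx Num.sg x0.

Lemma active_mxE (R : realType) n (x0 v : 'cV[R]_n) i :
  (active_mx x0 *m v) i 0 = (x0 i 0 != 0)%:R * v i 0.
Proof. by rewrite mul_diag_mx !mxE. Qed.

Lemma active_mx_id (R : realType) n (x0 v : 'cV[R]_n) :
  (forall i, x0 i 0 = 0 -> v i 0 = 0) -> active_mx x0 *m v = v.
Proof.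
move=> v0; apply/colP => i; rewrite active_mxE.
by case: eqP => [/v0 ->|_]; rewrite ?mulr0 ?mul1r.
Qed.

Lemma kkt_mxE (R : realType) m n (x0 v : 'cV[R]_n) (A : 'M[R]_(m, n)) i :
  (kkt_mx x0 A *m v) i 0 =
  if x0 i 0 == 0 then v i 0 else coldot A i (A *m (active_mx x0 *m v)).
Proof.
have addE (u v' w : 'cV[R]_n) : (u + (v' - w)) i 0 = u i 0 + (v' i 0 - w i 0).
  by rewrite !mxE.
rewrite /kkt_mx mulmxDl mulmxBl mul1mx -!mulmxA addE !active_mxE coldotE.
by case: eqP => _ /=; rewrite ?mul0r ?mul1r ?subrr ?addr0// subr0 add0r.
Qed.

(** If [kkt_mx x0 A] kills [w] then the identity block makes [w] supported on
[x0], and pairing with [w] gives [|A w|^2 = 0]. *)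
Lemma kkt_mx_unit (R : realType) m n (x0 : 'cV[R]_n) (A : 'M[R]_(m, n)) :
  kkt_mx x0 A \in unitmx <-> active_inj A x0.
Proof.
split=> [uK h h0 Ah|inj].
  have Kh : kkt_mx x0 A *m h = 0.
    apply/colP => i; rewrite kkt_mxE active_mx_id// Ah mxE.
    by case: eqP => [/h0 -> //|_]; rewrite coldotE mulmx0 mxE.
  by rewrite -(mulKmx uK h) Kh mulmx0.
rewrite -unitmx_tr -row_free_unit; apply: inj_row_free => v.
rewrite -[v]trmxK -trmx_mul => /(congr1 trmx); rewrite trmxK trmx0 => Kv.
rewrite trmxK in Kv.
set w := v^T in Kv *.
have w0 i : x0 i 0 = 0 -> w i 0 = 0.
  move=> xi; have /colP/(_ i) := Kv; rewrite kkt_mxE xi eqxx => ->.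
  by rewrite mxE.
suff w00 : w = 0 by rewrite -[v]trmxK -/w w00 trmx0.
apply: inj => //; apply: dot_eq0; rewrite -sum_coldot big1// => i _.
have /colP/(_ i) := Kv; rewrite kkt_mxE active_mx_id// [RHS]mxE.
by case: eqP => [/w0 -> |_ ->]; rewrite ?mulr0 ?mul0r.
Qed.

(** The equality part of the optimality conditions for the sign pattern of [x0]
is a square linear system, whose solution depends linearly on [(l, b)] and
rationally on [A]. *)
Lemma kkt_systemP (R : realType) m n (x0 x : 'cV[R]_n) l (b : 'cV[R]_m)
    (A : 'M[R]_(m, n)) : kkt_mx x0 A \in unitmx ->
  x = invmx (kkt_mx x0 A) *m kkt_rhs x0 l b A <->
  (forall i, x0 i 0 = 0 -> x i 0 = 0) /\
  (forall i, x0 i 0 <> 0 -> coldot A i (b - A *m x) = l * Num.sg (x0 i 0)).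
Proof.
move=> uK.
have rhsE i : kkt_rhs x0 l b A i 0 =
    if x0 i 0 == 0 then 0 else coldot A i b - l * Num.sg (x0 i 0).
  rewrite /kkt_rhs mxE -mulmxA active_mxE !mxE coldotE mxE.
  by case: eqP => [->|_] /=; rewrite ?sgr0 ?mulr0 ?mul0r ?subr0 ?mul1r.
have -> : x = invmx (kkt_mx x0 A) *m kkt_rhs x0 l b A <->
    kkt_mx x0 A *m x = kkt_rhs x0 l b A.
  by split=> [->|<-]; rewrite ?mulKVmx ?mulKmx.
split=> [/colP E|[x00 xE]].
  have x00 i : x0 i 0 = 0 -> x i 0 = 0.
    by move=> xi; have := E i; rewrite kkt_mxE rhsE xi eqxx.
  split=> // i /eqP /negPf xi; have := E i.
  rewrite kkt_mxE rhsE xi active_mx_id// coldotD coldotN => ->; ring.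
apply/colP => i; rewrite kkt_mxE rhsE active_mx_id//.
case: eqP => [/x00//|/xE]; rewrite coldotD coldotN => <-; ring.
Qed.

(** * Dual certificates *)

(** The entries of [x] vanish where [x0] does, and elsewhere have weakly the
sign of [x0]. *)
Definition sign_compat (R : realType) n (x0 x : 'cV[R]_n) :=
  forall i, Num.sg (x0 i 0) * x i 0 = `|x i 0|.

(** A vector witnessing that the sign pattern of [x0] belongs to [in_J A]. *)
Definition certificate (R : realType) m n (A : 'M[R]_(m, n)) (x0 : 'cV[R]_n)
    (y : 'cV[R]_m) :=
  forall i, if x0 i 0 == 0 then is_true (`|coldot A i y| < 1)
            else coldot A i y = Num.sg (x0 i 0).

Lemma certificate_norm1 (R : realType) m n (A : 'M[R]_(m, n)) (x0 : 'cV[R]_n)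
    (y : 'cV[R]_m) (x : 'cV[R]_n) : certificate A x0 y -> sign_compat x0 x ->
  dot y (A *m x) = norm1 x.
Proof.
move=> hy hx; rewrite -sum_coldot; apply: eq_bigr => i _; rewrite -hx.
have := hx i; have := hy i; case: eqP => [-> _|_ ->//].
by rewrite sgr0 mul0r => /esym/normr0_eq0 ->; rewrite mulr0.
Qed.

Lemma certificate_le (R : realType) m n (A : 'M[R]_(m, n)) (x0 : 'cV[R]_n)
    (y : 'cV[R]_m) (x : 'cV[R]_n) i : certificate A x0 y ->
  coldot A i y * x i 0 <= `|x i 0| ?= iff (coldot A i y * x i 0 == `|x i 0|).
Proof.
move=> hy; apply/leifP; case: ifPn => [/eqP//|ne].
rewrite lt_neqAle ne (le_trans (ler_norm _))// normrM ler_piMl//.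
have := hy i; case: eqP => [_ /ltW//|_ ->].
by rewrite normr_sg; case: (_ != 0).
Qed.

(** Weak duality: [y . A x' <= |x'|_1], with equality at [x]. *)
Lemma certificate_min (R : realType) m n (A : 'M[R]_(m, n)) (x0 : 'cV[R]_n)
    (y : 'cV[R]_m) (x x' : 'cV[R]_n) : certificate A x0 y -> sign_compat x0 x ->
  A *m x' = A *m x -> norm1 x <= norm1 x'.
Proof.
move=> hy hx xx'; rewrite -(certificate_norm1 hy hx) -xx' -sum_coldot.
by apply: ler_sum => i _; apply: (certificate_le x' i hy).
Qed.

(** Equality in weak duality holds entrywise, and [|A_i . y| < 1] off the support
of [x0] then forces [x'] to vanish there; independence of the active columns
finishes. *)
Lemma certificate_unique (R : realType) m n (A : 'M[R]_(m, n))
    (x0 : 'cV[R]_n) (y : 'cV[R]_m) (x x' : 'cV[R]_n) :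
  active_inj A x0 -> certificate A x0 y -> sign_compat x0 x ->
  A *m x' = A *m x -> norm1 x' <= norm1 x -> x' = x.
Proof.
move=> inj hy hx xx' le; apply/eqP; rewrite -subr_eq0; apply/eqP.
apply: inj; last by rewrite mulmxBr xx' subrr.
have /leif_sum /= : forall i, true -> coldot A i y * x' i 0 <= `|x' i 0|
    ?= iff (coldot A i y * x' i 0 == `|x' i 0|).
  by move=> i _; exact: (certificate_le x' i hy).
move=> [_].
rewrite sum_coldot xx' (certificate_norm1 hy hx) -/(norm1 x').
rewrite eq_le le (certificate_min hy hx xx') => /esym/forallP eqs i xi.
have hxi := hx i; rewrite xi sgr0 mul0r in hxi.
rewrite !mxE (normr0_eq0 (esym hxi)) subr0.
have := eqs i => /= /eqP e; have := hy i; rewrite xi eqxx => lt1.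
apply: contrapT => /eqP; rewrite -normr_gt0 => x'i.
have : `|x' i 0| < `|x' i 0|.
  by rewrite -{1}e (le_lt_trans (ler_norm _))// normrM gtr_pMl.
by rewrite ltxx.
Qed.

(** * The cones of the partition *)

Definition signs_of (R : realType) n (x0 : 'cV[R]_n) : signsets n :=
  SignSets [set i | 0 < x0 i 0]%SET [set i | x0 i 0 == 0]%SET
           [set i | x0 i 0 < 0]%SET.

Lemma signs_of_partition (R : realType) n (x0 : 'cV[R]_n) :
  index_partition (signs_of x0).
Proof.
split; apply/finset.setP => i; rewrite !inE;
  by case: (ltgtP (x0 i 0) 0) => //= ->; rewrite ?ltxx ?eqxx.
Qed.

Lemma coneG_signs_of (R : realType) m n (A : 'M[R]_(m, n)) (x0 : 'cV[R]_n)
    l b x :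
  coneG A (signs_of x0) (l, b, x) <->
  [/\ 0 <= l, sign_compat x0 x,
      forall i, x0 i 0 <> 0 -> coldot A i (b - A *m x) = l * Num.sg (x0 i 0) &
      forall i, x0 i 0 = 0 -> `|coldot A i (b - A *m x)| <= l].
Proof.
rewrite /coneG /=; split=> [[l0 P Z N]|[l0 C E I]].
  split=> // i.
  - case: (ltgtP (x0 i 0) 0) => xi.
    + have [|xn _] := N i; first by rewrite inE.
      by rewrite ltr0_sg// ler0_norm// mulN1r.
    + have [|xp _] := P i; first by rewrite inE.
      by rewrite gtr0_sg// ger0_norm// mul1r.
    + have [|-> _] := Z i; first by rewrite inE xi.
      by rewrite mulr0 normr0.
  - move=> /eqP; case: (ltgtP (x0 i 0) 0) => xi // _.
    + have [|_ ->] := N i; first by rewrite inE.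
      by rewrite ltr0_sg// mulrN1.
    + have [|_ ->] := P i; first by rewrite inE.
      by rewrite gtr0_sg// mulr1.
  - by move=> xi; have [|//] := Z i; rewrite inE xi.
split=> // i; rewrite inE => xi.
- split; first by have := C i; rewrite gtr0_sg// mul1r => ->.
  by rewrite E; [rewrite gtr0_sg// mulr1|exact/eqP/lt0r_neq0].
- move/eqP: xi => xi; split; last exact: I.
  by have := C i; rewrite xi sgr0 mul0r => /esym/normr0_eq0.
- split; first by have := C i; rewrite ltr0_sg// mulN1r -oppr_ge0 => ->.
  by rewrite E; [rewrite ltr0_sg// mulrN1|exact/eqP/ltr0_neq0].
Qed.

Lemma kkt_coneG (R : realType) m n (A : 'M[R]_(m, n)) (T : signsets n) l b x :
  index_partition T -> coneG A T (l, b, x) -> kkt l b A x.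
Proof.
move=> [_ _ _ cov] [l0 P Z N] i.
have : i \in Ipos T :|: Izer T :|: Ineg T by rewrite cov inE.
rewrite !inE -orbA => /or3P[/P|/Z|/N] [xi ci].
- by rewrite ci !ger0_norm.
- by rewrite xi mulr0 normr0 mulr0.
- by rewrite ci normrN (ger0_norm l0) (ler0_norm xi) mulrN mulNr.
Qed.

(** All points of the cone are covered, including those where an inactive
constraint is tight: there the residual no longer certifies uniqueness, but the
fixed vector [y] does, because all minimizers share the same fit and the same
l1-norm. For [l = 0] the cone equations say that the residual is orthogonal to
the range, and [y] is a certificate for basis pursuit. *)
Lemma solS_coneG (R : realType) m n (A : 'M[R]_(m, n)) (x0 : 'cV[R]_n)
    (y : 'cV[R]_m) l b x :
  active_inj A x0 -> certificate A x0 y -> coneG A (signs_of x0) (l, b, x) ->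
  solS l b A = [set x].
Proof.
move=> inj hy hG.
have /coneG_signs_of[l0 C E I] := hG.
have hk := kkt_coneG (signs_of_partition x0) hG.
have [l_gt0|] := boolP (0 < l).
  apply/seteqP; split=> [x' /(solS_kkt _ _ _ l_gt0) hk'|_ ->]; last first.
    exact/solS_kkt.
  have fit := kkt_fit hk' hk.
  apply: (certificate_unique inj hy C fit).
  by rewrite -(ler_pM2l l_gt0) -(kkt_norm1 hk) -(kkt_norm1 hk') fit.
rewrite lt_neqAle l0 andbT negbK => /eqP l00; subst l.
rewrite /solS ltxx eqxx.
have -> : proj_rge A b = A *m x.
  apply: proj_rgeE; apply/colP => i; rewrite -coldotE mxE -opprB coldotN.
  by have [] := hk i; rewrite normr_le0 => /eqP -> _; rewrite oppr0.
apply/seteqP; split=> [x' [/= fit le]|_ ->].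
  by apply: (certificate_unique inj hy C fit); exact: le.
by split=> // x' /= fit; exact: (certificate_min hy C fit).
Qed.

(** * The smooth branch of solutions *)

Definition branch (R : realType) m n (x0 : 'cV[R]_n)
    (z : R * 'cV[R]_m * 'M[R]_(m, n)) : 'cV[R]_n :=
  invmx (kkt_mx x0 z.2) *m kkt_rhs x0 z.1.1 z.1.2 z.2.

Lemma smooth_linear_fun (R : realType) (V W : normedModType R) (U : set V)
  (f : V -> W) : linear f -> continuous f -> smooth_on U f.
Proof.
move=> lf; pose fL : {linear V -> W} :=
  HB.pack f (GRing.isLinear.Build _ _ _ _ f lf).
exact: (@smooth_linear _ _ _ U fL).
Qed.

Lemma smooth_param (R : realType) m n (U : set (R * 'cV[R]_m * 'M[R]_(m, n))) :
  [/\ smooth_on U (fun z => z.1.1), smooth_mx U (fun z => z.1.2) &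
      smooth_mx U (fun z => z.2)].
Proof.
split=> [|i j|i j]; apply: smooth_linear_fun.
- by move=> a u v.
- move=> z; apply: (@continuous_comp _ _ _ fst fst); exact: cvg_fst.
- by move=> a u v; rewrite !mxE.
- move=> z; apply: (@continuous_comp _ _ _ (fun z => z.1.2)
    (fun M : 'cV[R]_m => M i j)); last exact: coord_continuous.
  apply: (@continuous_comp _ _ _ fst snd); [exact: cvg_fst|exact: cvg_snd].
- by move=> a u v; rewrite !mxE.
- move=> z; apply: (@continuous_comp _ _ _ snd
    (fun M : 'M[R]_(m, n) => M i j)); [exact: cvg_snd|exact: coord_continuous].
Qed.

Lemma smooth_kkt_mx (R : realType) m n (x0 : 'cV[R]_n)
    (U : set (R * 'cV[R]_m * 'M[R]_(m, n))) : open U ->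
  smooth_mx U (fun z => kkt_mx x0 z.2).
Proof.
move=> oU; have [_ _ sA] := smooth_param U.
apply: (smooth_mxD oU _ (smooth_mx_cst _ _)).
apply: (smooth_mxM oU _ (smooth_mx_cst _ _)).
apply: (smooth_mxM oU _ sA).
by apply: (smooth_mxM oU (smooth_mx_cst _ _)); exact: smooth_mxT.
Qed.

Lemma open_kkt_mx_unit (R : realType) m n (x0 : 'cV[R]_n) :
  open [set z : R * 'cV[R]_m * 'M[R]_(m, n) | kkt_mx x0 z.2 \in unitmx].
Proof.
have cdet : continuous
    (fun z : R * 'cV[R]_m * 'M[R]_(m, n) => \det (kkt_mx x0 z.2)).
  move=> z; have sK :=
    smooth_kkt_mx x0 (@openT (R * 'cV[R]_m * 'M[R]_(m, n))%type).
  exact: (smooth_det openT sK 0%N).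
have -> : [set z : R * 'cV[R]_m * 'M[R]_(m, n) | kkt_mx x0 z.2 \in unitmx] =
    (fun z => \det (kkt_mx x0 z.2)) @^-1` [set a | a != 0].
  by apply/seteqP; split=> z /=; rewrite unitmxE unitfE.
apply: open_comp => [z _|]; [exact: cdet|exact: open_neq].
Qed.

Lemma smooth_mx_branch (R : realType) m n (x0 : 'cV[R]_n) :
  smooth_mx [set z : R * 'cV[R]_m * 'M[R]_(m, n) | kkt_mx x0 z.2 \in unitmx]
    (branch x0).
Proof.
set U := [set _ | _]; have oU : open U := @open_kkt_mx_unit R m n x0.
have [sl sb sA] := smooth_param U.
apply: (smooth_mxM oU).
  by apply: (smooth_invmx oU) => //; exact: smooth_kkt_mx.
rewrite /kkt_rhs; under eq_fun do rewrite -scaleNr.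
apply: (smooth_mxD oU).
  apply: (smooth_mxM oU _ sb).
  by apply: (smooth_mxM oU (smooth_mx_cst _ _)); exact: smooth_mxT.
apply: (smooth_mxZ oU _ (smooth_mx_cst _ _)) => k.
have c1 : Ck_on k U (cst (-1) : R * 'cV[R]_m * 'M[R]_(m, n) -> R).
  exact: smooth_cst.
apply: Ck_eq (CkM oU c1 (sl k)) => // z _.
by rewrite !fctE mulN1r.
Qed.

Lemma smooth_branch (R : realType) m n (x0 : 'cV[R]_n) :
  smooth_on [set z : R * 'cV[R]_m * 'M[R]_(m, n) | kkt_mx x0 z.2 \in unitmx]
    (branch x0).
Proof.
exact: smooth_of_mx (@open_kkt_mx_unit R m n x0) (@smooth_mx_branch R m n x0).
Qed.

Lemma smooth_coldot_branch (R : realType) m n (x0 : 'cV[R]_n) i :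
  smooth_on [set z : R * 'cV[R]_m * 'M[R]_(m, n) | kkt_mx x0 z.2 \in unitmx]
    (fun z => coldot z.2 i (z.1.2 - z.2 *m branch x0 z)).
Proof.
set U := [set _ | _]; have oU : open U := @open_kkt_mx_unit R m n x0.
have [_ sb sA] := smooth_param U.
under eq_fun do rewrite coldotE -scaleN1r.
have sAx := smooth_mxM oU sA (@smooth_mx_branch R m n x0).
have sr := smooth_mxD oU sb (smooth_mxZ oU (smooth_cst U (-1 : R)) sAx).
exact: (smooth_mxM oU (smooth_mxT sA) sr i 0).
Qed.

(** The inequalities among the optimality conditions, in strict form, for the
candidate [branch x0 z]. *)
Definition strict_at (R : realType) m n (x0 : 'cV[R]_n) (i : 'I_n) :
    set (R * 'cV[R]_m * 'M[R]_(m, n)) :=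
  [set z | if x0 i 0 == 0
    then is_true (`|coldot z.2 i (z.1.2 - z.2 *m branch x0 z)| < z.1.1)
    else is_true (0 < Num.sg (x0 i 0) * branch x0 z i 0)].

Definition strict_region (R : realType) m n (x0 : 'cV[R]_n) :
    set (R * 'cV[R]_m * 'M[R]_(m, n)) :=
  [set z | [/\ 0 < z.1.1, kkt_mx x0 z.2 \in unitmx &
    forall i, strict_at x0 i z]].

Lemma nbhs_strict_region (R : realType) m n (x0 : 'cV[R]_n)
    (z0 : R * 'cV[R]_m * 'M[R]_(m, n)) :
  strict_region x0 z0 -> \forall z \near z0, strict_region x0 z.
Proof.
move=> [l0 uK hi].
set U := [set z : R * 'cV[R]_m * 'M[R]_(m, n) | kkt_mx x0 z.2 \in unitmx].
have oU : open U := @open_kkt_mx_unit R m n x0.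
have [sl sb sA] := smooth_param U.
have cl : z.1.1 @[z --> z0] --> z0.1.1 := sl 0%N z0 uK.
have near_i : \forall z \near z0, forall i, strict_at x0 i z.
  apply: (@filter_forall _ _ (@strict_at R m n x0) (nbhs z0)) => i.
  have := hi i; rewrite /strict_at /=.
  case: eqP => _ h.
    have cc := @smooth_coldot_branch R m n x0 i 0%N z0 uK.
    move: h; rewrite -subr_gt0 => h.
    apply: filterS (cvgr_gt _ (cvgB cl (cvg_norm cc)) _ h) => z.
    by rewrite subr_gt0.
  have cb := @smooth_mx_branch R m n x0 i 0 0%N z0 uK.
  have cs := cvgMl_tmp (a := Num.sg (x0 i 0)) cb.
  exact: (cvgr_gt _ (cs _) _ h).
have near_l : \forall z \near z0, 0 < z.1.1 := cvgr_gt _ cl 0 l0.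
have near_U : \forall z \near z0, U z := open_nbhs_nbhs (conj oU uK).
apply: filterS2 (filterI (near_l _) near_U) near_i => z [lz Uz] iz.
by split.
Qed.

(** The normalized residual at a strict point is itself a certificate. *)
Lemma strict_regionP (R : realType) m n (x0 : 'cV[R]_n)
    (z : R * 'cV[R]_m * 'M[R]_(m, n)) : strict_region x0 z ->
  [/\ active_inj z.2 x0,
      certificate z.2 x0 (z.1.1^-1 *: (z.1.2 - z.2 *m branch x0 z)) &
      coneG z.2 (signs_of x0) (z.1, branch x0 z)].
Proof.
case: z => [[l b] A] [/= l0 uK hi]; set x := branch x0 (l, b, A) in hi *.
have [x00 xE] : (forall i, x0 i 0 = 0 -> x i 0 = 0) /\
  (forall i, x0 i 0 <> 0 -> coldot A i (b - A *m x) = l * Num.sg (x0 i 0)).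
  by apply/kkt_systemP.
split; first exact/kkt_mx_unit.
- move=> i; have := xE i; have := hi i; rewrite /strict_at /= -/x.
  case: eqP => [_ lt _|xi _ /(_ xi) ex].
    by rewrite coldotZ normrM gtr0_norm ?invr_gt0// mulrC ltr_pdivrMr// mul1r.
  by rewrite coldotZ ex mulKf// lt0r_neq0.
- apply/coneG_signs_of; split=> //; first exact: ltW.
    move=> i; have := hi i; rewrite /strict_at /=.
    case: eqP => [x0i _|/eqP x0i /ltW ge0].
      by rewrite x00// mulr0 normr0.
    by rewrite -[LHS]ger0_norm// normrM normr_sg x0i mul1r.
  by move=> i x0i; have := hi i; rewrite /strict_at /= x0i eqxx => /ltW.
Qed.

Lemma strict_region_solS (R : realType) m n (x0 : 'cV[R]_n)
    (z : R * 'cV[R]_m * 'M[R]_(m, n)) : strict_region x0 z ->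
  solS z.1.1 z.1.2 z.2 = [set branch x0 z].
Proof.
move=> /strict_regionP; case: z => [[l b] A] /= [inj cert hG].
exact: (solS_coneG inj cert hG).
Qed.

Lemma condition13_strict_region (R : realType) m n (A : 'M[R]_(m, n)) b l x :
  0 < l -> solS l b A x ->
  free [seq col i A | i <- enum 'I_n & x i 0 != 0] ->
  (forall i, x i 0 = 0 -> `|coldot A i (b - A *m x)| < l) ->
  branch x (l, b, A) = x /\ strict_region x (l, b, A).
Proof.
move=> l0 /(solS_kkt _ _ _ l0) hk /free_active inj lt.
have uK : kkt_mx x A \in unitmx by exact/kkt_mx_unit.
have bx : branch x (l, b, A) = x.
  apply/esym/kkt_systemP => //; split=> // i /eqP xi.
  have [_] := hk i; rewrite normrEsg mulrA.
  exact: mulIf.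
split=> //; split=> // i; rewrite /strict_at /= bx.
case: eqP => [/lt//|/eqP xi].
by rewrite -normrEsg normr_gt0.
Qed.

(** * Necessity of strictness *)

(** The difference quotients of such a [g] are [1] on the right and nonpositive
on the left, so they have no common limit. *)
Lemma no_kink (R : realType) (g : R -> R) : derivable g 0 1 ->
  g 0 = 0 -> (\forall t \near 0, 0 <= g t) ->
  ~ (\forall t \near 0, 0 < t -> g t = t).
Proof.
move=> dg g0 pos right.
pose q (h : R) : R := h^-1 * (g (h *: 1 + 0) - g 0).
have q_cvg : q h @[h --> 0^'] --> lim (q h @[h --> 0^']) by exact: dg.
have half : 0 < 2^-1 :> R by rewrite invr_gt0 ltr0n.
move: (lim _) q_cvg => l /cvgrPdist_lt /(_ _ half) near_q.
have : \forall t \near 0, t != 0 -> `|l - t^-1 * g t| < 2^-1.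
  move: near_q; rewrite near_withinE; apply: filterS => t h /h.
  by rewrite /q /= g0 subr0 addr0 [t *: 1]mulr1.
move=> /filterI /(_ (filterI pos right)) /nbhs_ballP [e /= e0 he].
have e2 : 0 < e / 2 by rewrite divr_gt0.
have [|hp [_ gp]] := he (e / 2).
  by rewrite /ball /= sub0r normrN gtr0_norm// ltr_pdivrMr// ltr_pMr// ltr1n.
have [|hn [gn _]] := he (- (e / 2)).
  by rewrite /ball /= sub0r opprK gtr0_norm// ltr_pdivrMr// ltr_pMr// ltr1n.
move: hp; rewrite gp// mulVf ?lt0r_neq0// => /(_ isT).
move: hn; rewrite oppr_eq0 lt0r_neq0// => /(_ isT).
have : (- (e / 2))^-1 * g (- (e / 2)) <= 0.
  by rewrite invrN mulNr oppr_le0 mulr_ge0// invr_ge0 ltW.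
move: (_ * g _) => a a0; rewrite !ltr_norml => /andP[h1 h2] /andP[h3 h4].
lra.
Qed.

(** A dependence [h] between active columns can be added to [x] in a small
multiple without changing fit or signs, giving a second solution. *)
Lemma solS_unique_free (R : realType) m n (l : R) (b : 'cV[R]_m)
    (A : 'M[R]_(m, n)) x : 0 < l -> solS l b A = [set x] ->
  free [seq col i A | i <- enum 'I_n & x i 0 != 0].
Proof.
move=> l0 Sx; have solx : solS l b A x by rewrite Sx.
have hk := (solS_kkt b A x l0).1 solx.
apply/free_active => h h0 Ah.
have : forall i, \forall t \near 0, x i 0 != 0 ->
    0 < Num.sg (x i 0) * (x i 0 + t * h i 0).
  move=> i; have [xi|xi] := eqVneq (x i 0) 0;
    first by apply: (@nearW _ (nbhs (0 : R))).
  have : Num.sg (x i 0) * (x i 0 + t * h i 0) @[t --> 0] -->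
      Num.sg (x i 0) * (x i 0 + 0 * h i 0).
    apply: cvgMl_tmp; apply: cvgD; first exact: cvg_cst.
    by apply: cvgMr_tmp; exact: cvg_id.
  move=> /cvgr_gt /(_ 0); rewrite mul0r addr0 -normrEsg normr_gt0 => /(_ xi).
  by apply: filterS.
move=> /filter_forall /nbhs_ballP [e /= e0 he].
have e2 : 0 < e / 2 by rewrite divr_gt0.
have he2 : ball 0 e (e / 2).
  by rewrite /ball /= sub0r normrN gtr0_norm// ltr_pdivrMr// ltr_pMr// ltr1n.
have : solS l b A (x + (e / 2) *: h).
  apply/solS_kkt => // i; rewrite mulmxDr -scalemxAr Ah scaler0 addr0.
  have [bd xE] := hk i; split=> //; rewrite !mxE.
  have [xi|xi] := eqVneq (x i 0) 0.
    by rewrite xi h0// mulr0 addr0 normr0 !mulr0.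
  have pos := he _ he2 i xi.
  move: xE; rewrite [`|x i 0|]normrEsg mulrA => /(mulIf xi) ->.
  by rewrite -mulrA -[Num.sg _ * _]gtr0_norm// normrM normr_sg xi mul1r.
rewrite Sx /= => /eqP; rewrite -subr_eq0 addrC addKr scaler_eq0.
by rewrite gt_eqF//= => /eqP.
Qed.

(** If an inactive constraint [i] is tight with sign [s], move [b] along
[s *: col i A]: forward, the solution picks up the multiple [t * s] of the
[i]-th basis vector with unchanged residual; backward, its [i]-th entry cannot
take the sign opposite to [s]. So [s] times that entry has a kink at [0]. Only
differentiability along lines in [b] is involved, which is why this serves both
a smooth and a linear solution map. *)
Lemma condition13_of_curves (R : realType) m n (l : R) (b : 'cV[R]_m)
    (A : 'M[R]_(m, n)) : 0 < l ->
  (forall v : 'cV[R]_m, exists2 f : R -> 'cV[R]_n, derivable f 0 1 &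
    \forall t \near 0, solS l (b + t *: v) A = [set f t]) ->
  condition13 l b A.
Proof.
move=> l0 curves.
have [x Sx] : exists x, solS l b A = [set x].
  have [f _ /nbhs_singleton] := curves 0; rewrite scale0r addr0 => fE.
  by exists (f 0).
have solx : solS l b A x by rewrite Sx.
have hk := (solS_kkt b A x l0).1 solx.
exists x; split=> //; first exact: (solS_unique_free l0 Sx).
move=> i xi; have [bd _] := hk i; rewrite lt_neqAle bd andbT; apply/eqP => act.
set s := Num.sg (coldot A i (b - A *m x)).
have ss : s * s = 1.
  by rewrite -expr2 sqr_sg -normr_gt0 act l0.
have cE : coldot A i (b - A *m x) = s * l by rewrite -act -numEsg.
have [f df Sf] := curves (s *: col i A).
have f0 : f 0 = x.
  have := nbhs_singleton Sf; rewrite scale0r addr0 Sx.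
  by move=> /seteqP[/(_ x erefl)].
pose g t := s * f t i 0.
have dfi : derivable (fun t => f t i 0) 0 1 by exact: (derivable_mxP f 0 1).1.
apply: (@no_kink R g).
- apply: derivableM => //; exact: derivable_cst.
- by rewrite /g f0 xi mulr0.
(* Near [0] the constraint [i] keeps the sign [s] by continuity, and
   complementarity passes this sign on to [f t i 0]. *)
- have cf : {for 0, continuous f}.
    exact/differentiable_continuous/derivable1_diffP.
  have cr : s * coldot A i (b + t *: (s *: col i A) - A *m f t) @[t --> 0]
     --> s * coldot A i (b - A *m x).
    apply: cvgMl_tmp.
    have rE t : coldot A i (b + t *: (s *: col i A) - A *m f t) =
        coldot A i b + t * coldot A i (s *: col i A)
        - \sum_j (A^T *m A) i j * f t j 0.
      by rewrite !coldotD coldotN coldotZ (coldotE _ _ (A *m _)) mulmxA mxE.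
    under eq_fun do rewrite rE.
    have -> : coldot A i (b - A *m x) = coldot A i b +
        0 * coldot A i (s *: col i A) - \sum_j (A^T *m A) i j * f 0 j 0.
      by rewrite -rE scale0r addr0 f0.
    apply: cvgB.
      by apply: cvgD; [exact: cvg_cst|apply: cvgMr_tmp; exact: cvg_id].
    apply: cvg_big => [|j _]; first exact: add_continuous.
    apply: cvgMl_tmp.
    apply: (@continuous_comp _ _ _ f (fun M : 'cV[R]_n => M j 0)) => //.
    exact: coord_continuous.
  have pos : 0 < s * coldot A i (b - A *m x) by rewrite cE mulrA ss mul1r.
  apply: filterS2 Sf (cvgr_gt _ cr _ pos) => t St rt.
  have /solS_kkt /(_ i) [] // : solS l (b + t *: (s *: col i A)) A (f t).
    by rewrite St.
  move=> _ e; rewrite -(pmulr_rge0 _ rt) /g mulrACA ss mul1r e.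
  by rewrite mulr_ge0// ltW.
(* The data move along with the solution, so the residual does not change. *)
- apply: filterS Sf => t St t0; rewrite /g.
  suff : solS l (b + t *: (s *: col i A)) A (x + (t * s) *: delta_mx i 0).
    rewrite St /= => <-.
    by rewrite !mxE xi !eqxx add0r mulr1 mulrCA ss mulr1.
  apply/solS_kkt => // j.
  have -> : b + t *: (s *: col i A) - A *m (x + (t * s) *: delta_mx i 0) =
      b - A *m x.
    by rewrite mulmxDr -scalemxAr -colE scalerA opprD addrACA subrr addr0.
  have [bdj ej] := hk j; split=> //; rewrite !mxE.
  have [->|ji] := eqVneq j i; last by rewrite mulr0 addr0.
  rewrite xi add0r mulr1 cE normrM (gtr0_norm t0).
  have -> : `|s| = 1 by rewrite normr_sg -normr_gt0 act l0.
  by rewrite mulr1 -[RHS]mul1r -ss; ring.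
Qed.

(** An inactive constraint of a strict solution is not tight, hence cannot be
one of the equations defining the cone of [T]. *)
Lemma coneG_strict_signs (R : realType) m n (A : 'M[R]_(m, n))
    (T : signsets n) l b x : index_partition T -> coneG A T (l, b, x) ->
  (forall i, x i 0 = 0 -> `|coldot A i (b - A *m x)| < l) -> signs_of x = T.
Proof.
move=> [_ _ _ cov] [l0 P Z N] lt.
have mem i : [|| i \in Ipos T, i \in Izer T | i \in Ineg T].
  by move/finset.setP/(_ i): cov; rewrite !inE -orbA.
have pos i : i \in Ipos T -> 0 < x i 0.
  move=> /P [xi ci]; rewrite lt_neqAle xi andbT eq_sym; apply/eqP => /lt.
  by rewrite ci ger0_norm// ltxx.
have neg i : i \in Ineg T -> x i 0 < 0.
  move=> /N [xi ci]; rewrite lt_neqAle xi andbT; apply/eqP => /lt.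
  by rewrite ci normrN ger0_norm// ltxx.
have zer i : i \in Izer T -> x i 0 = 0 by move=> /Z [].
case: T {cov P Z N} mem pos neg zer => Tp Tz Tn /= mem pos neg zer.
rewrite /signs_of; congr SignSets; apply/finset.setP => i; rewrite !inE;
  apply/idP/idP => [xi|]; do ?by [move/pos|move/neg|move/zer/eqP].
- by have /or3P[//|/zer xz|/neg /(lt_trans xi)] := mem i;
    rewrite ?xz ltxx in xi *.
- have /or3P[/pos|//|/neg] := mem i; first by rewrite (eqP xi) ltxx.
  by rewrite (eqP xi) ltxx.
- by have /or3P[/pos /(lt_trans xi)|/zer xz|//] := mem i;
    rewrite ?xz ltxx in xi *.
Qed.

Lemma continuous_pair (T U V : topologicalType) (f : T -> U) (g : T -> V) x :
  {for x, continuous f} -> {for x, continuous g} ->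
  {for x, continuous (fun y => (f y, g y))}.
Proof.
by move=> fx gx; apply: (@cvg_pair _ _ _ (nbhs x) (nbhs (f x)) (nbhs (g x))).
Qed.

Lemma continuous_line (R : realType) (V : normedModType R) (b v : V) (s : R) :
  {for s, continuous (fun t : R => b + t *: v)}.
Proof.
apply: cvgD; first exact: cvg_cst.
by apply: cvgZr_tmp; exact: cvg_id.
Qed.

(** * Equivalence of strictness, smoothness and linearity *)

Theorem proposition4p2 (R : realType) (m n : nat) (lambda : R)
    (b : 'cV[R]_m) (A : 'M[R]_(m, n)) (lambda_gt0 : 0 < lambda) :
  [<-> condition13 lambda b A;
       smooth_around
         (fun z : R * 'cV[R]_m * 'M[R]_(m, n) => solS z.1.1 z.1.2 z.2)
         (lambda, b, A);
       exists T : signsets n,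
         unique (fun T' => in_J A T' /\ (projG A T')° (lambda, b)) T /\
         linear_on (fun lb : R * 'cV[R]_m => solS lb.1 lb.2 A) (projG A T)].
Proof.
have smooth13 : smooth_around
    (fun z : R * 'cV[R]_m * 'M[R]_(m, n) => solS z.1.1 z.1.2 z.2)
    (lambda, b, A) -> condition13 lambda b A.
  move=> [U [oU U0 [f fE fs]]].
  apply: condition13_of_curves => // v.
  pose p t : R * 'cV[R]_m * 'M[R]_(m, n) := (lambda, b + t *: v, A).
  exists (f \o p).
    have [fd _] := fs 1%N.
    have := @diff_derivable _ _ _ f _ (0, v, 0) (fd _ U0).
    have pE h : p (h *: 1 + 0) = h *: (0, v, 0) + (lambda, b, A).
      rewrite /p addr0 [h *: 1]mulr1 [b + _]addrC.
      by congr (_, _, _); rewrite /= scaler0 add0r.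
    have p0 : p 0 = (lambda, b, A) by rewrite /p scale0r addr0.
    rewrite /derivable => fc.
    under eq_fun => h do rewrite /= pE p0.
    exact: fc.
  have cp : {for 0, continuous p}.
    apply: continuous_pair; last exact: cst_continuous.
    by apply: continuous_pair; [exact: cst_continuous|exact: continuous_line].
  have p0 : p 0 = (lambda, b, A) by rewrite /p scale0r addr0.
  have : \forall t \near 0, U (p t).
    by apply: cp; rewrite p0; exact: open_nbhs_nbhs.
  by apply: filterS => t /fE.
tfae.
- move=> [x [Sx fr lt]].
  have [_ reg] := condition13_strict_region lambda_gt0 Sx fr lt.
  have near_reg := nbhs_strict_region reg.
  exists ((@strict_region R m n x)°); split.
  + exact: open_interior.
  + exact: near_reg.
  + exists (branch x) => [z /interior_subset|k]; first exact: strict_region_solS.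
    apply: (Ck_sub _ (@smooth_branch R m n x k)) => z /interior_subset.
    by case.
- move=> /smooth13 [x [Sx fr lt]].
  have [bx reg] := condition13_strict_region lambda_gt0 Sx fr lt.
  have [/= inj cert hG] := strict_regionP reg.
  have uK : kkt_mx x A \in unitmx by exact/kkt_mx_unit.
  have Sx1 := strict_region_solS reg.
  rewrite /= bx in cert hG Sx1.
  exists (signs_of x); split; first split.
  + split.
      split; first exact: signs_of_partition.
      exists (lambda^-1 *: (b - A *m x)); split=> i; rewrite inE => xi;
        have := cert i.
      * by rewrite gt_eqF// gtr0_sg.
      * by rewrite xi.
      * by rewrite lt_eqF// ltr0_sg.
    have cA : {for (lambda, b), continuous (fun lb : R * 'cV[R]_m => (lb, A))}.
      by apply: continuous_pair; [exact: cvg_id|exact: cst_continuous].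
    have : \forall lb \near (lambda, b), strict_region x (lb, A).
      by apply: cA; exact: nbhs_strict_region.
    apply: filterS => lb /strict_regionP [_ _ hG'].
    by exists (lb, branch x (lb, A)).
  + move=> T' [[partT' _] /interior_subset [[[l' b'] x'] hG' [el eb]]].
    subst l' b'.
    have hk' := kkt_coneG partT' hG'.
    have x'x : x' = x.
      by have := (solS_kkt _ _ _ lambda_gt0).2 hk'; rewrite Sx1.
    subst x'; exact: coneG_strict_signs partT' hG' lt.
  + have lin : linear (fun lb : R * 'cV[R]_m =>
        invmx (kkt_mx x A) *m kkt_rhs x lb.1 lb.2 A).
      move=> a u v; rewrite /kkt_rhs /= scalemxAr -mulmxDr; congr (_ *m _).
      rewrite mulmxDr -scalemxAr scalerBr scalerDl scalerA opprD.
      by rewrite addrACA.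
    pose F (lb : R * 'cV[R]_m) : 'cV[R]_n :=
      invmx (kkt_mx x A) *m kkt_rhs x lb.1 lb.2 A.
    pose L : {linear (R * 'cV[R]_m)%type -> 'cV[R]_n} :=
      HB.pack F (GRing.isLinear.Build _ _ _ _ F lin).
    exists L => _ [[[l' b'] x'] hG' <-] /=.
    rewrite (solS_coneG inj cert hG'); congr [set _].
    apply/kkt_systemP => //; have /coneG_signs_of [_ C E _] := hG'.
    split=> // i xi; have := C i; rewrite xi sgr0 mul0r.
    by move=> /esym/normr0_eq0.
(* A linear solution map is affine along the lines in [b]. *)
- move=> [T [[[_ intT] _] [L hL]]].
  apply: condition13_of_curves => // v.
  exists (fun t => L (lambda, b) + t *: L (0, v)).
    apply: derivableD; first exact: derivable_cst.
    by apply: diff_derivable; exact: differentiableZl.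
  have cp : {for 0, continuous (fun t : R => (lambda, b + t *: v))}.
    by apply: continuous_pair; [exact: cst_continuous|exact: continuous_line].
  have : \forall t \near 0, projG A T (lambda, b + t *: v).
    by apply: cp; rewrite scale0r addr0.
  apply: filterS => t /hL /= ->; congr [set _].
  rewrite -linearZ -linearD; congr (L _).
  by congr (_, _); rewrite /= ?scaler0 ?addr0.
Qed.
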